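(* Let $\mu$ be a Borel probability measure on $\mathbb{R}$, and let $\lambda_\mu$ be its Höffding measure. Then $\lambda=\lambda_\mu$ is the unique positive, locally finite Borel measure on $\mathbb{R}\times\mathbb{R}$ such that $$ \mathrm{cov}_\mu(u,v)=\int_{-\infty}^\infty\int_{-\infty}^\infty u'(x)\,v'(y)\,d\lambda(x,y) \qquad ( * ) $$ for all $u,v\in C_b^\infty$. Moreover, with $\lambda=\lambda_\mu$, the identity $( * )$ extends to all locally absolutely continuous, complex-valued functions $u,v$ on $\mathbb{R}$ such that $$ \int_{-\infty}^\infty\int_{-\infty}^\infty |u'(x)|\,|u'(y)|\,d\lambda(x,y)<\infty,\qquad \int_{-\infty}^\infty\int_{-\infty}^\infty |v'(x)|\,|v'(y)|\,d\lambda(x,y)<\infty, $$ where the derivatives $u'$ and $v'$ are understood in the Radon-Nikodym sense. The Höffding measure $\lambda_\mu$ is finite if and only if $\mu$ has a finite second moment.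
   Context: For a Borel probability measure $\mu$ on $\mathbb{R}$ with distribution function $F(x)=\mu((-\infty,x])$, the Höffding kernel is $$H_\mu(x,y)=F(x\wedge y)\,(1-F(x\vee y)),\quad x,y\in\mathbb{R},$$ where $x\wedge y=\min(x,y)$ and $x\vee y=\max(x,y)$. The Höffding measure $\lambda_\mu$ is the positive measure on $\mathbb{R}\times\mathbb{R}$ with density $H_\mu(x,y)$ with respect to Lebesgue measure $dx\,dy$. Locally finite means finite on compact sets. The covariance is $\mathrm{cov}_\mu(u,v)=\int uv\,d\mu-\int u\,d\mu\int v\,d\mu$ (without complex conjugation). $C_b^\infty$ denotes the class of all functions $u:\mathbb{R}\to\mathbb{R}$ having a $C^\infty$-smooth, compactly supported derivative (such functions are bounded). *)

(* Defs.v *)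
From HB Require Import structures.
From mathcomp Require Import all_boot all_order all_algebra.
From mathcomp Require Import all_classical all_reals all_analysis.
From mathcomp Require Import measurable_realfun complex.

Set Implicit Arguments.
Unset Strict Implicit.
Unset Printing Implicit Defensive.

Import Order.TTheory GRing.Theory Num.Theory.
Import numFieldNormedType.Exports.
Import ComplexField.Normc.

Local Open Scope classical_set_scope.
Local Open Scope ring_scope.

Section hoeffding.
Context {R : realType} (mu : probability (measurableTypeR R) R).

Definition distr_fun (x : R) : R := fine (mu `]-oo, x]%classic).

Definition hoeffding_kernel (x y : R) : R :=
  distr_fun (Num.min x y) * (1 - distr_fun (Num.max x y)).

Definition hoeffding_measure (A : set (measurableTypeR R * measurableTypeR R))
    : \bar R :=
  (\int[lebesgue_measure \x lebesgue_measure]_(z in A)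
     (hoeffding_kernel z.1 z.2)%:E)%E.

Lemma distr_fun_ge0 x : 0 <= distr_fun x.
Proof. exact: fine_ge0. Qed.

Lemma distr_fun_le1 x : distr_fun x <= 1.
Proof.
by rewrite -[1]/(fine 1%:E) fine_le ?fin_num_measure// probability_le1.
Qed.

Lemma distr_fun_nd : nondecreasing_fun distr_fun.
Proof.
move=> x y xy; rewrite fine_le ?fin_num_measure// le_measure ?inE//.
exact: subitvPr.
Qed.

Lemma hoeffding_kernel_ge0 x y : 0 <= hoeffding_kernel x y.
Proof. by rewrite mulr_ge0 ?distr_fun_ge0// subr_ge0 distr_fun_le1. Qed.

Lemma measurable_hoeffding_kernel :
  measurable_fun [set: measurableTypeR R * measurableTypeR R]
    (fun z => hoeffding_kernel z.1 z.2).
Proof.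
have mF : measurable_fun [set: R] distr_fun.
  exact: (nondecreasing_measurable _ distr_fun_nd).
apply: measurable_funM; last apply: measurable_funB => //.
- by apply: (measurableT_comp mF); apply: measurable_minr.
- by apply: (measurableT_comp mF); apply: measurable_maxr.
Qed.

Let hoeffding_measure0 : hoeffding_measure set0 = 0%E.
Proof. by rewrite /hoeffding_measure integral_set0. Qed.

Let hoeffding_measure_ge0 A : (0 <= hoeffding_measure A)%E.
Proof.
by apply: integral_ge0 => z _; rewrite lee_fin hoeffding_kernel_ge0.
Qed.

Let hoeffding_measure_sigma_additive : semi_sigma_additive hoeffding_measure.
Proof.
move=> F mF tF mUF; rewrite /hoeffding_measure; apply: cvg_toP.
  apply: ereal_nondecreasing_is_cvgn => m n mn.
  apply: lee_sum_nneg_natr => // k _ _; apply: integral_ge0 => z _.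
  by rewrite lee_fin hoeffding_kernel_ge0.
rewrite ge0_integral_bigcup//=.
- apply/measurable_funTS/measurableT_comp => //.
  exact: measurable_hoeffding_kernel.
- by move=> z _; rewrite lee_fin hoeffding_kernel_ge0.
Qed.

HB.instance Definition _ := isMeasure.Build _ _ _ hoeffding_measure
  hoeffding_measure0 hoeffding_measure_ge0 hoeffding_measure_sigma_additive.

End hoeffding.

(* [measurable] on the product is the product sigma-algebra, i.e. the Borel
   sigma-algebra of the plane; [compact] refers to the product topology. *)
Definition locally_finite {R : realType}
    (lam : set (measurableTypeR R * measurableTypeR R) -> \bar R) : Prop :=
  forall K : set (R * R), compact K -> (lam K < +oo)%E.

Section smooth.
Context {R : realType}.

Definition smooth (f : R -> R) : Prop :=
  forall (n : nat) (x : R), derivable (derive1n n f) x 1.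

Definition compactly_supported (f : R -> R) : Prop :=
  compact (closure [set x | f x != 0]).

Definition Cb_infty (u : R -> R) : Prop :=
  [/\ forall x, derivable u x 1, smooth (derive1 u)
    & compactly_supported (derive1 u)].

(* Only used for bounded [u], [v], where all three integrals converge;
   [Rintegral] is 0 when the integral is infinite. *)
Definition cov (mu : probability (measurableTypeR R) R) (u v : R -> R) : R :=
  Rintegral mu setT (fun x => u x * v x)
  - Rintegral mu setT u * Rintegral mu setT v.

Definition covariance_identity (mu : probability (measurableTypeR R) R)
    (lam : {measure set (measurableTypeR R * measurableTypeR R) -> \bar R})
    (u v : R -> R) : Prop :=
  cov mu u v = Rintegral lam setT (fun z => derive1 u z.1 * derive1 v z.2).

End smooth.

Section complex_integral.
Context d (T : measurableType d) (R : realType).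
Variable mu : {measure set T -> \bar R}.

Definition cintegrable (D : set T) (f : T -> R[i]) : Prop :=
  mu.-integrable D (fun x => (complex.Re (f x))%:E) /\
  mu.-integrable D (fun x => (complex.Im (f x))%:E).

Definition cintegral (D : set T) (f : T -> R[i]) : R[i] :=
  Complex (Rintegral mu D (fun x => complex.Re (f x)))
          (Rintegral mu D (fun x => complex.Im (f x))).

End complex_integral.

Section complex_functions.
Context {R : realType}.

(* Bilinear: no conjugation on [v]. *)
Definition ccov (mu : probability (measurableTypeR R) R) (u v : R -> R[i])
    : R[i] :=
  cintegral mu setT (fun x => u x * v x)
  - cintegral mu setT u * cintegral mu setT v.

Definition absolutely_continuous_on (a b : R) (f : R -> R[i]) : Prop :=
  forall e : R, 0 < e -> exists2 delta : R, 0 < delta &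
    forall (n : nat) (s t : 'I_n -> R),
      (forall i, [/\ a <= s i, s i <= t i & t i <= b]) ->
      trivIset setT (fun i => `]s i, t i[%classic) ->
      \sum_(i < n) (t i - s i) < delta ->
      \sum_(i < n) normc (f (t i) - f (s i)) < e.

Definition locally_absolutely_continuous (f : R -> R[i]) : Prop :=
  forall a b : R, absolutely_continuous_on a b f.

(* [df] is a density, with respect to Lebesgue measure, of the complex
   set function determined by ]a, b] |-> f b - f a; it is unique only up to
   Lebesgue-null sets, hence a relation. *)
Definition radon_nikodym_derivative (f df : R -> R[i]) : Prop :=
  [/\ locally_integrable setT (fun x => complex.Re (df x)),
      locally_integrable setT (fun x => complex.Im (df x))
    & forall a b : R, a <= b ->
        f b - f a = cintegral lebesgue_measure `[a, b]%classic df].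

End complex_functions.

(* Main.v *)
Require Import Defs.
From HB Require Import structures.
From mathcomp Require Import all_boot all_order all_algebra.
From mathcomp Require Import all_classical all_reals all_analysis.
From mathcomp Require Import measurable_realfun complex ring lra.

Set Implicit Arguments.
Unset Strict Implicit.
Unset Printing Implicit Defensive.

Import Order.TTheory GRing.Theory Num.Theory.
Import numFieldNormedType.Exports.
Import ComplexField.Normc.

(** Let [X] and [Y] be independent with law [mu] and put, for [w = (X, Y)],
    [jump w x = 1{X <= x} - 1{Y <= x}].  Two facts carry the whole proof.

    - If [f'] is a density of [f], then integrating [f' x * jump w x] in [x]
      gives [f Y - f X], whatever the order of [X] and [Y]
      ([Rintegral_jump]).
    - The expectation of [jump w x * jump w y] is twice the covariance of
      [1{X <= x}] and [1{X <= y}], that is, twice the Hoeffding kernel at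
      [(x, y)] ([integral_jumpM]).  Moreover [jump w x * jump w y >= 0], since
      the sign of [jump w] depends only on the order of [X] and [Y].

    Integrating [f' x * g' y * jump w x * jump w y] over [x], [y] and [w] in
    both orders therefore shows that twice the integral of [f' x * g' y]
    against the Hoeffding measure is [E((f Y - f X) * (g Y - g X))], which is
    twice the covariance of [f] and [g] ([fubini_jump],
    [covariance_symmetrized]).

    Integrability comes from the same computation with absolute values, where
    Tonelli's theorem applies.  Positivity of the product of jumps turns the
    hypothesis on [|f' x| * |f' y|] into integrability of [(f Y - f X)^2];
    freezing a good value of [X] shows that [f] is square integrable, and the
    inequality [a * b <= a^2 + b^2], for the integrals [a] of [|f'| * |jump w|]
    and [b] of [|g'| * |jump w|], controls the mixed term [|f' x| * |g' y|]
    ([real_covariance_identity]).  Complex functions are treated by applying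
    the real case to the four pairs of real and imaginary parts.

    For uniqueness, the identity for smooth test functions determines the
    integral of every product of two smooth compactly supported functions.
    The functions [bumpf a b n] increase to the indicator of [`]a, b[], so by
    monotone convergence the values on bounded open rectangles are
    determined, and these rectangles form a pi-system that generates the Borel
    sets and exhausts the plane ([measure_eq_bump]).

    The criterion for finiteness is the case [f x = x], [f' = 1]: the total
    mass of the Hoeffding measure is half the expectation of [(Y - X)^2]
    ([second_moment]). *)

Local Open Scope classical_set_scope.
Local Open Scope ring_scope.

(** * Integration against a density *)

Section density.
Local Open Scope ereal_scope.
Context d (T : measurableType d) (R : realType).
Variables (m nu : {measure set T -> \bar R}) (h : T -> R).
Hypothesis mh : measurable_fun setT h.
Hypothesis h0 : forall x, (0 <= h x)%R.
Hypothesis nuE : forall A, measurable A -> nu A = \int[m]_(x in A) (h x)%:E.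

Import HBNNSimple.

Let density_nnsfun (f : {nnsfun T >-> R}) :
  \int[nu]_x (f x)%:E = \int[m]_x ((f x)%:E * (h x)%:E).
Proof.
have mi r : measurable (f @^-1` [set r]) by [].
transitivity (\int[nu]_x
   (\sum_(y \in range f) (y * \1_(f @^-1` [set y]) x)%:E)).
  by apply: eq_integral => t _; rewrite fimfunE -fsumEFin.
rewrite ge0_integral_fsum//; last 2 first.
- by move=> r; apply/measurable_EFinP; exact: measurable_funM.
- by move=> r x _; exact: nnfun_muleindic_ge0.
transitivity (\int[m]_x (\sum_(y \in range f)
    ((y * \1_(f @^-1` [set y]) x)%:E * (h x)%:E))); last first.
  apply: eq_integral => x _; rewrite -ge0_mule_fsuml => [|y].
    by rewrite fsumEFin// -(fimfunE _ x).
  exact: nnfun_muleindic_ge0.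
rewrite ge0_integral_fsum//; last 2 first.
- move=> r; apply: emeasurable_funM; apply/measurable_EFinP => //.
  exact: measurable_funM.
- by move=> r x _; apply: mule_ge0; [exact: nnfun_muleindic_ge0|rewrite lee_fin].
apply: eq_fsbigr => r /set_mem[y _ <-].
rewrite integralZl_indic_nnsfun//= integral_indic// setIT nuE//.
under [RHS]eq_integral do rewrite EFinM -muleA.
rewrite ge0_integralZl//; last 3 first.
- by apply: emeasurable_funM; apply/measurable_EFinP.
- by move=> x _; rewrite mule_ge0// lee_fin.
- by rewrite lee_fin.
congr (_ * _); rewrite integral_mkcond; apply: eq_integral => x _.
by rewrite epatch_indic muleC.
Qed.

(** By monotone convergence it is enough to treat simple functions, for which
    the formula is the definition of [nu] on the level sets. *)
Lemma ge0_integral_density (f : T -> \bar R) :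
  measurable_fun setT f -> (forall x, 0 <= f x) ->
  \int[nu]_x f x = \int[m]_x (f x * (h x)%:E).
Proof.
move=> mf f0.
pose g := nnsfun_approx measurableT mf.
have gf x : (g n x)%:E @[n --> \oo] --> f x by exact: cvg_nnsfun_approx.
have nd x : nondecreasing_seq (fun n => (g n x)%:E).
  by move=> a b ab; rewrite lee_fin; exact/lefP/nd_nnsfun_approx.
transitivity (limn (fun n => \int[nu]_x (g n x)%:E)).
  rewrite -monotone_convergence//; last 2 first.
  - by move=> n; exact/measurable_EFinP.
  - by move=> n x _; rewrite lee_fin.
  by apply: eq_integral => x _; apply/esym/cvg_lim.
transitivity (limn (fun n => \int[m]_x ((g n x)%:E * (h x)%:E))).
  by congr (limn _); apply/funext => n; exact: density_nnsfun.
rewrite -monotone_convergence//; last 3 first.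
- by move=> n; apply: emeasurable_funM; exact/measurable_EFinP.
- by move=> n x _; rewrite mule_ge0 ?lee_fin.
- by move=> x _ a b ab; rewrite lee_wpmul2r ?lee_fin//; exact/lefP/nd_nnsfun_approx.
apply: eq_integral => x _; apply/cvg_lim => //.
by apply: cvgeZr.
Qed.

Lemma integrable_density (f : T -> R) :
  measurable_fun setT f ->
  nu.-integrable setT (EFin \o f) <->
  m.-integrable setT (EFin \o (fun x => f x * h x)%R).
Proof.
move=> mf.
have E : \int[nu]_x `|(f x)%:E| = \int[m]_x `|(f x * h x)%:E|.
  rewrite ge0_integral_density//.
    by apply: eq_integral => x _; rewrite EFinM abseM
      (gee0_abs (h0 x : 0 <= (h x)%:E)).
  by apply: measurableT_comp => //; exact/measurable_EFinP.
split=> /integrableP[_ i]; apply/integrableP; split.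
- by apply/measurable_EFinP; exact: measurable_funM.
- by rewrite -E.
- exact/measurable_EFinP.
- by rewrite E.
Qed.

Lemma integral_density (f : T -> R) :
  measurable_fun setT f ->
  \int[nu]_x (f x)%:E = \int[m]_x (f x * h x)%:E.
Proof.
move=> mf.
rewrite integralE [RHS]integralE.
congr (_ - _).
  rewrite ge0_integral_density//; last first.
    by apply: measurable_funepos; exact/measurable_EFinP.
  apply: eq_integral => x _.
  by rewrite !funeposE EFinM maxe_pMl ?lee_fin// mul0e.
rewrite ge0_integral_density//; last first.
  by apply: measurable_funeneg; exact/measurable_EFinP.
apply: eq_integral => x _.
by rewrite !funenegE EFinM -mulNe maxe_pMl ?lee_fin// mul0e.
Qed.

End density.

(** * Products of sigma-finite measures and the jump kernel *)

Section product_sigma_finite.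
Context d1 d2 (T1 : measurableType d1) (T2 : measurableType d2) (R : realType).
Variable m1 : {sigma_finite_measure set T1 -> \bar R}.
Variable m2 : {sigma_finite_measure set T2 -> \bar R}.

Lemma sigma_finite_product : sigma_finite setT (m1 \x m2)%E.
Proof.
have [F TF Foo] := sigma_finiteT m1; have [G TG Goo] := sigma_finiteT m2.
exists (fun k => if unpickle k is Some ij then F ij.1 `*` G ij.2 else set0).
  apply/seteqP; split => // -[x y] _.
  have [i _ Fix] : (\bigcup_i F i) x by rewrite -TF.
  have [j _ Gjy] : (\bigcup_i G i) y by rewrite -TG.
  by exists (pickle (i, j)) => //; rewrite pickleK.
move=> k; case: unpickle => [[i j]|]; last by split => //; rewrite measure0.
have [mFi Fi] := Foo i; have [mGj Gj] := Goo j.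
split; first exact: measurableX.
by rewrite product_measure1E//= lte_mul_pinfty// ge0_fin_numE.
Qed.

(** The product with its sigma-finite structure bundled, so that it can itself
    be a factor of a product measure. *)
Definition product_sf : {sigma_finite_measure set (T1 * T2)%type -> \bar R} :=
  HB.pack (m1 \x m2)%E
   (Measure_isSigmaFinite.Build _ _ _ (m1 \x m2)%E sigma_finite_product).

End product_sigma_finite.

Section integrable_section_integral.
Local Open Scope ereal_scope.
Context d1 d2 (T1 : measurableType d1) (T2 : measurableType d2) (R : realType).
Variable m1 : {sigma_finite_measure set T1 -> \bar R}.
Variable m2 : {sigma_finite_measure set T2 -> \bar R}.

(** The norm of a section integral is at most the section integral of the
    norm, which is integrable by Tonelli. *)
Lemma integrable_section_integral (f : T1 * T2 -> \bar R) :
  (m1 \x m2).-integrable setT f -> m2.-integrable setT (fubini_G m1 f).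
Proof.
move=> fi; have mf := measurable_int _ fi.
apply/integrableP; split; first exact: (measurable_fubini_G fi).
apply: le_lt_trans ((integrable21ltyP m1 m2 mf).1 fi).
apply: ge0_le_integral => //.
- by apply: measurableT_comp => //; exact: (measurable_fubini_G fi).
- apply: (measurable_fun_fubini_tonelli_G (abse \o f)) => //=.
  exact: measurableT_comp.
- move=> y _; apply: le_abse_integral => //.
  exact: (measurable_comp measurableT _ mf).
Qed.

End integrable_section_integral.

Section tensor.
Local Open Scope ereal_scope.
Context d1 d2 (T1 : measurableType d1) (T2 : measurableType d2) (R : realType).
Variable m1 : {sigma_finite_measure set T1 -> \bar R}.
Variable m2 : {sigma_finite_measure set T2 -> \bar R}.

Lemma measurable_tensor (f : T1 -> R) (g : T2 -> R) :
  measurable_fun setT f -> measurable_fun setT g ->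
  measurable_fun setT (fun z : T1 * T2 => f z.1 * g z.2)%R.
Proof.
move=> mf mg; apply: measurable_funM.
  by apply: measurableT_comp.
by apply: measurableT_comp.
Qed.

Lemma ge0_integral_tensor (f : T1 -> R) (g : T2 -> R) :
  measurable_fun setT f -> measurable_fun setT g ->
  (forall x, (0 <= f x)%R) -> (forall y, (0 <= g y)%R) ->
  \int[m1 \x m2]_z (f z.1 * g z.2)%:E =
  (\int[m1]_x (f x)%:E) * (\int[m2]_y (g y)%:E).
Proof.
move=> mf mg f0 g0.
rewrite fubini_tonelli1//; last 2 first.
- by apply/measurable_EFinP; exact: measurable_tensor.
- by move=> z; rewrite lee_fin mulr_ge0.
rewrite /fubini_F/=.
under eq_integral => x _.
  under eq_integral => y _ do rewrite EFinM.
  rewrite ge0_integralZl//; last 3 first.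
  - exact/measurable_EFinP.
  - by move=> y _; rewrite lee_fin.
  - by rewrite lee_fin.
  over.
rewrite ge0_integralZr//.
- exact/measurable_EFinP.
- by move=> x _; rewrite lee_fin.
- by apply: integral_ge0 => y _; rewrite lee_fin.
Qed.

Lemma integrable_tensor (f : T1 -> R) (g : T2 -> R) :
  m1.-integrable setT (EFin \o f) -> m2.-integrable setT (EFin \o g) ->
  (m1 \x m2).-integrable setT (EFin \o (fun z => f z.1 * g z.2)%R).
Proof.
move=> /integrableP[/measurable_EFinP mf fi] /integrableP[/measurable_EFinP mg gi].
apply/integrableP; split; first by apply/measurable_EFinP; exact: measurable_tensor.
under eq_integral do rewrite /= normrM.
rewrite (ge0_integral_tensor (f := Num.norm \o f) (g := Num.norm \o g))//=;
  try exact: measurableT_comp.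
by rewrite lte_mul_pinfty// ?integral_ge0// ge0_fin_numE// integral_ge0.
Qed.

Lemma integral_tensor (f : T1 -> R) (g : T2 -> R) :
  m1.-integrable setT (EFin \o f) -> m2.-integrable setT (EFin \o g) ->
  \int[m1 \x m2]_z (f z.1 * g z.2)%:E =
  (\int[m1]_x (f x)%:E) * (\int[m2]_y (g y)%:E).
Proof.
move=> fi gi; rewrite -integral12_prod_meas1; last exact: integrable_tensor.
rewrite /fubini_F/=.
under eq_integral => x _.
  under eq_integral => y _ do rewrite EFinM.
  rewrite integralZl//.
  over.
rewrite -(fineK (integrable_fin_num measurableT gi)).
by rewrite integralZr.
Qed.

Lemma Rintegral_tensor (f : T1 -> R) (g : T2 -> R) :
  m1.-integrable setT (EFin \o f) -> m2.-integrable setT (EFin \o g) ->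
  Rintegral (m1 \x m2) setT (fun z => f z.1 * g z.2)%R =
  (Rintegral m1 setT f * Rintegral m2 setT g)%R.
Proof.
move=> fi gi; rewrite /Rintegral integral_tensor// fineM//;
  exact: integrable_fin_num.
Qed.

End tensor.

Section jump.
Context {R : realType}.
Notation T := (measurableTypeR R * measurableTypeR R)%type.

(** Seen as a function of [x], this is the indicator of [[w.1, w.2[] counted
    positively when [w.1 <= w.2] and of [[w.2, w.1[] counted negatively
    otherwise: the kernel that turns a density into an increment. *)
Definition jump (w : T) (x : R) : R :=
  (if w.1 <= x then 1 else 0) - (if w.2 <= x then 1 else 0).

Lemma measurable_jump d (S : measurableType d) (w : S -> T) (x : S -> R) :
  measurable_fun setT w -> measurable_fun setT x ->
  measurable_fun setT (fun s => jump (w s) (x s)).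
Proof.
move=> mw mx; apply: measurable_funB.
  apply: measurable_fun_ifT => //; apply: measurable_fun_ler => //.
  by apply: (measurableT_comp (measurable_fst : measurable_fun _ _)).
apply: measurable_fun_ifT => //; apply: measurable_fun_ler => //.
by apply: (measurableT_comp (measurable_snd : measurable_fun _ _)).
Qed.

Lemma jumpE (w : T) x : jump w x =
  (if w.1 <= w.2 then 1 else -1) *
  \1_(`[Num.min w.1 w.2, Num.max w.1 w.2[%classic) x.
Proof.
rewrite indicE /jump.
have -> : (x \in `[Num.min w.1 w.2, Num.max w.1 w.2[%classic) =
  (Num.min w.1 w.2 <= x < Num.max w.1 w.2).
  by apply/idP/idP; [move=> /set_mem|move=> h; apply/mem_set]; rewrite /= in_itv.
rewrite minEle maxEle; case: (leP w.1 w.2) => h12;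
  case: (leP w.1 x) => h1; case: (leP w.2 x) => h2 /=; rewrite ?h1 ?h2; try lra.
Qed.

Lemma norm_jump (w : T) x :
  `|jump w x| = \1_(`[Num.min w.1 w.2, Num.max w.1 w.2[%classic) x.
Proof.
rewrite jumpE normrM [X in X * _](_ : _ = 1) ?mul1r.
  by rewrite ger0_norm// indicE.
by case: ifP => _; rewrite ?normrN normr1.
Qed.

(** The sign of [jump w] is the same at all points, so it squares away.  This
    is what makes the same kernel serve for Tonelli and for Fubini. *)
Lemma norm_jumpM (w : T) x y : `|jump w x| * `|jump w y| = jump w x * jump w y.
Proof.
rewrite !norm_jump !jumpE.
by case: ifP => _; ring.
Qed.

(** Both jumps are nonzero only if one of [w.1], [w.2] lies weakly below [x]
    and [y] and the other lies strictly above both; the two orders give the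
    two rectangles. *)
Lemma jumpM (w : T) x y : jump w x * jump w y =
  \1_(`]-oo, Num.min x y]%classic `*` `]Num.max x y, +oo[%classic) w +
  \1_(`]Num.max x y, +oo[%classic `*` `]-oo, Num.min x y]%classic) w.
Proof.
rewrite !indicE !in_setX /jump.
have E1 t : (t \in `]-oo, Num.min x y]%classic) = (t <= x) && (t <= y).
  by rewrite -le_min; apply/idP/idP; [move=> /set_mem|move=> h; apply/mem_set];
    rewrite /= in_itv.
have E2 t : (t \in `]Num.max x y, +oo[%classic) = (x < t) && (y < t).
  by rewrite -gt_max; apply/idP/idP; [move=> /set_mem|move=> h; apply/mem_set];
    rewrite /= in_itv/= andbT.
rewrite !E1 !E2.
case: (leP w.1 x) => h1x; case: (leP w.1 y) => h1y; case: (leP w.2 x) => h2x;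
  case: (leP w.2 y) => h2y /=; try lra.
Qed.

End jump.

(** * The Fubini identity behind the covariance formula *)

Section fubini_jump.
Context {R : realType} (mu : probability (measurableTypeR R) R).
Notation T := (measurableTypeR R * measurableTypeR R)%type.
Notation leb := (@lebesgue_measure R).
Notation H := (hoeffding_kernel mu).
Notation lam := (hoeffding_measure mu).
Notation leb2 := (product_sf leb leb).
Notation mu2 := (product_sf mu mu).

(** Each of the two rectangles of [jumpM] has measure
    [F (min x y) * (1 - F (max x y))]. *)
Lemma integral_jumpM x y :
  (\int[mu \x mu]_w (jump w x * jump w y)%:E = (2 * H x y)%:E)%E.
Proof.
under eq_integral do rewrite jumpM EFinD.
set A := `]-oo, _]%classic; set B := `]_, +oo[%classic.
have mA : measurable (A : set (measurableTypeR R)) by exact: measurable_itv.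
have mB : measurable (B : set (measurableTypeR R)) by exact: measurable_itv.
have mAB := measurableX mA mB; have mBA := measurableX mB mA.
rewrite ge0_integralD//; try by [move=> w _; rewrite lee_fin|
  apply/measurable_EFinP; exact: measurable_indic].
rewrite !integral_indic// !setIT.
transitivity (mu A * mu B + mu B * mu A)%E.
  by congr (_ + _)%E; exact: product_measure1E.
have muA : mu A = (distr_fun mu (Num.min x y))%:E.
  by rewrite /distr_fun fineK// fin_num_measure.
have muB : mu B = (1 - distr_fun mu (Num.max x y))%:E.
  rewrite /B -setCitvl probability_setC// EFinB; congr (_ - _)%E.
  by rewrite /distr_fun fineK// fin_num_measure.
by rewrite muA muB -!EFinM -EFinD /hoeffding_kernel; congr EFin; ring.
Qed.

Lemma integrable_jumpM x y :
  (mu \x mu)%E.-integrable setT (EFin \o (fun w => jump w x * jump w y)).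
Proof.
apply/integrableP; split.
  apply/measurable_EFinP; apply: measurable_funM; exact: measurable_jump.
under eq_integral do rewrite /= normrM norm_jumpM.
by rewrite integral_jumpM ltry.
Qed.

Lemma measurable_jump4 (p q : R -> R) :
  measurable_fun setT p -> measurable_fun setT q ->
  measurable_fun setT
    (fun zw : T * T =>
       (p zw.1.1 * q zw.1.2) * (jump zw.2 zw.1.1 * jump zw.2 zw.1.2)).
Proof.
move=> mp mq; apply: measurable_funM.
  apply: (measurableT_comp (measurable_tensor mp mq) measurable_fst).
apply: measurable_funM; apply: measurable_jump => //;
  by [apply: (measurableT_comp (measurable_fst : measurable_fun _ _))|
      apply: (measurableT_comp (measurable_snd : measurable_fun _ _))].
Qed.

(** Integrating in [w] first produces the Hoeffding kernel; integrating in the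
    plane variable first splits the integrand as a product, because for fixed
    [w] it is a function of [x] times a function of [y]. *)
Lemma tonelli_jump (p q : R -> R) :
  measurable_fun setT p -> measurable_fun setT q ->
  (forall x, 0 <= p x) -> (forall x, 0 <= q x) ->
  (2%:E * \int[lam]_z (p z.1 * q z.2)%:E =
   \int[mu \x mu]_w ((\int[leb]_x (p x * `|jump w x|)%:E) *
                     (\int[leb]_y (q y * `|jump w y|)%:E)))%E.
Proof.
move=> mp mq p0 q0.
have mpq := measurable_tensor mp mq.
rewrite (@ge0_integral_density _ _ _ (leb \x leb)%E _ (fun z => H z.1 z.2))//; first last.
- by move=> z; rewrite lee_fin mulr_ge0.
- exact/measurable_EFinP.
- by move=> z; exact: hoeffding_kernel_ge0.
- exact: measurable_hoeffding_kernel.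
rewrite -ge0_integralZl//; last 2 first.
- apply/measurable_EFinP; apply: measurable_funM => //.
  exact: measurable_hoeffding_kernel.
- by move=> z _; apply: mule_ge0; rewrite lee_fin;
    [rewrite mulr_ge0|exact: hoeffding_kernel_ge0].
pose G (zw : T * T) :=
  ((p zw.1.1 * q zw.1.2) * (jump zw.2 zw.1.1 * jump zw.2 zw.1.2))%:E.
have mG : measurable_fun setT G by apply/measurable_EFinP; exact: measurable_jump4.
have G0 zw : (0 <= G zw)%E.
  by rewrite lee_fin -norm_jumpM !mulr_ge0.
transitivity (\int[leb \x leb]_z \int[mu \x mu]_w G (z, w))%E.
  apply: eq_integral => z _; rewrite /G/=.
  under eq_integral do rewrite EFinM.
  rewrite ge0_integralZl//; first last.
  - by rewrite lee_fin mulr_ge0.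
  - by move=> w _; rewrite lee_fin -norm_jumpM mulr_ge0.
  - apply/measurable_EFinP; apply: measurable_funM; exact: measurable_jump.
  by rewrite integral_jumpM -!EFinM; congr EFin; ring.
transitivity (\int[mu \x mu]_w \int[leb \x leb]_z G (z, w))%E.
  exact: (@fubini_tonelli _ _ T T R leb2 mu2 G mG G0).
apply: eq_integral => w _.
under eq_integral do rewrite /G/= -norm_jumpM mulrACA.
have mJ (r : R -> R) : measurable_fun setT r ->
    measurable_fun setT (fun x => r x * `|jump w x|).
  move=> mr; apply: measurable_funM => //; apply: measurableT_comp => //.
  exact: measurable_jump.
rewrite (ge0_integral_tensor leb leb (mJ p mp) (mJ q mq))//.
- by move=> x; rewrite mulr_ge0.
- by move=> x; rewrite mulr_ge0.
Qed.

(** The signed counterpart of [tonelli_jump].  The finiteness hypothesis is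
    exactly integrability of the four-variable integrand, since
    [jump w x * jump w y] is nonnegative with integral twice the kernel. *)
Lemma fubini_jump (p q : R -> R) :
  measurable_fun setT p -> measurable_fun setT q ->
  (forall w, leb.-integrable setT (EFin \o (fun x => p x * jump w x))) ->
  (forall w, leb.-integrable setT (EFin \o (fun x => q x * jump w x))) ->
  (\int[lam]_z (`|p z.1| * `|q z.2|)%:E < +oo)%E ->
  [/\ lam.-integrable setT (EFin \o (fun z => p z.1 * q z.2)),
      (mu \x mu)%E.-integrable setT
        (EFin \o (fun w => Rintegral leb setT (fun x => p x * jump w x) *
                  Rintegral leb setT (fun y => q y * jump w y)))
    & Rintegral (mu \x mu)%E setT
        (fun w => Rintegral leb setT (fun x => p x * jump w x) *
                  Rintegral leb setT (fun y => q y * jump w y)) =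
      2 * Rintegral lam setT (fun z => p z.1 * q z.2)].
Proof.
move=> mp mq ip iq fin.
have mpq := measurable_tensor mp mq.
have mpqH : measurable_fun [set: T] (fun z => p z.1 * q z.2 * H z.1 z.2).
  by apply: measurable_funM => //; exact: measurable_hoeffding_kernel.
have ilam : lam.-integrable setT (EFin \o (fun z => p z.1 * q z.2)).
  apply/integrableP; split; first exact/measurable_EFinP.
  by under eq_integral do rewrite /= normrM.
have iH : (leb \x leb)%E.-integrable setT
    (EFin \o (fun z => p z.1 * q z.2 * H z.1 z.2)).
  apply/(integrable_density (nu := lam) (h := fun z => H z.1 z.2)) => //.
  - exact: measurable_hoeffding_kernel.
  - by move=> z; exact: hoeffding_kernel_ge0.
pose G (zw : T * T) :=
  ((p zw.1.1 * q zw.1.2) * (jump zw.2 zw.1.1 * jump zw.2 zw.1.2))%:E.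
have mG : measurable_fun setT G by apply/measurable_EFinP; exact: measurable_jump4.
have iG : (leb2 \x mu2)%E.-integrable setT G.
  apply/(@integrable12ltyP _ _ T T R leb2 mu2) => //.
  have -> : (\int[leb2]_z \int[mu2]_w `|G (z, w)|)%E =
    (\int[leb \x leb]_z (2%:E * `|(p z.1 * q z.2 * H z.1 z.2)%:E|))%E.
    apply: eq_integral => z _; rewrite /G/=.
    under eq_integral do rewrite normrM [X in _ * X]normrM norm_jumpM EFinM.
    rewrite ge0_integralZl//; first last.
    - by move=> w _; rewrite lee_fin -norm_jumpM mulr_ge0.
    - apply/measurable_EFinP; apply: measurable_funM; exact: measurable_jump.
    have H0 := hoeffding_kernel_ge0 mu z.1 z.2.
    rewrite integral_jumpM (normrM (p z.1 * q z.2)) (ger0_norm H0) -!EFinM.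
    by congr EFin; ring.
  rewrite ge0_integralZl//; last first.
    by apply: measurableT_comp => //; exact/measurable_EFinP.
  by apply: lte_mul_pinfty => //; move/integrableP : iH => [].
have GwE w : fubini_G leb2 G w =
    (Rintegral leb setT (fun x => p x * jump w x) *
     Rintegral leb setT (fun y => q y * jump w y))%:E.
  rewrite /fubini_G/=.
  under eq_integral do rewrite /G/= mulrACA.
  have fp := integrable_fin_num measurableT (ip w).
  have fq := integrable_fin_num measurableT (iq w).
  by rewrite (integral_tensor (ip w) (iq w)) EFinM /Rintegral !fineK.
have GzE z : fubini_F mu2 G z = (2%:E * (p z.1 * q z.2 * H z.1 z.2)%:E)%E.
  rewrite /fubini_F/= /G/=.
  under eq_integral do rewrite EFinM.
  rewrite integralZl//; last exact: integrable_jumpM.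
  by rewrite integral_jumpM -!EFinM; congr EFin; ring.
split => //.
  have := @integrable_section_integral _ _ T T R leb2 mu2 G iG.
  by apply: eq_integrable => // w _; exact: GwE.
rewrite /Rintegral.
have -> : (\int[mu \x mu]_w ((Rintegral leb setT (fun x => p x * jump w x) *
     Rintegral leb setT (fun y => q y * jump w y))%:E) =
     2%:E * \int[lam]_z (p z.1 * q z.2)%:E)%E.
  rewrite (@integral_density _ _ _ (leb \x leb)%E lam (fun z => H z.1 z.2))//; first last.
  - by move=> z; exact: hoeffding_kernel_ge0.
  - exact: measurable_hoeffding_kernel.
  rewrite -integralZl//.
  transitivity (\int[mu2]_w fubini_G leb2 G w)%E.
    by apply: eq_integral => w _; exact/esym/GwE.
  rewrite integral21_prod_meas1// -integral12_prod_meas1//.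
  by apply: eq_integral => z _; exact: GzE.
by rewrite fineM//; exact: integrable_fin_num.
Qed.

End fubini_jump.

(** * The covariance identity for real functions *)

Section square_integrable.
Context {R : realType} (mu : probability (measurableTypeR R) R).
Implicit Types h k : R -> R.

(** By Fubini [h - h x] is square integrable for almost every [x], hence for
    some [x] since [mu] is not zero; adding back the constant [h x] preserves
    square integrability because [mu] is finite. *)
Lemma integrable_sqr_diff h : measurable_fun setT h ->
  (mu \x mu)%E.-integrable setT
    (EFin \o (fun w => (h w.2 - h w.1) * (h w.2 - h w.1))) ->
  mu.-integrable setT (EFin \o (fun x => h x * h x)).
Proof.
move=> mh ih.
have := @ae_integrable1 _ _ _ _ _ mu mu _ ih.
move=> [N [mN N0 sub]].
have [x ix] : exists x, mu.-integrable setT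
    (fun y => ((h y - h x) * (h y - h x))%:E).
  apply: contrapT => /forallNP nex.
  have : mu setT = 0%E.
    apply/eqP; rewrite eq_le measure_ge0 andbT -N0.
    apply: le_measure; rewrite ?inE// => x _; apply: sub => /= ix.
    exact: (nex x).
  by rewrite probability_setT => -[/eqP]; rewrite oner_eq0.
pose D y := (h y - h x) * (h y - h x).
have i2 : mu.-integrable setT (EFin \o (fun y => 2 * D y + 2 * (h x * h x))).
  have i0 := integrableZl measurableT 2 ix.
  have ic := finite_measure_integrable_cst mu (2 * (h x * h x)) measurableT.
  by apply: eq_integrable (integrableD measurableT i0 ic) => // y _ /=.
apply: (le_integrable measurableT _ _ i2).
  by apply/measurable_EFinP; exact: measurable_funM.
move=> y _ /=; rewrite lee_fin.
rewrite !ger0_norm; last 2 first.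
- by have := sqr_ge0 (h y - h x); have := sqr_ge0 (h x); rewrite /D; nra.
- by rewrite -expr2 sqr_ge0.
(* [h^2 <= 2 (h - c)^2 + 2 c^2] is [0 <= (h - 2 c)^2] with [c = h x]. *)
have := sqr_ge0 (h y - 2 * h x); rewrite /D; nra.
Qed.

Lemma integrable_of_sqr h : measurable_fun setT h ->
  mu.-integrable setT (EFin \o (fun x => h x * h x)) ->
  mu.-integrable setT (EFin \o h).
Proof.
move=> mh ih.
have i1 := finite_measure_integrable_cst mu 1 measurableT.
have i2 := integrableD measurableT ih i1.
apply: (le_integrable measurableT _ _ i2); first exact/measurable_EFinP.
move=> y _ /=; rewrite lee_fin.
rewrite [leRHS]ger0_norm; last by rewrite addr_ge0// -expr2 sqr_ge0.
have -> : h y * h y = `|h y| * `|h y| by rewrite -normrM ger0_norm// -expr2 sqr_ge0.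
have := sqr_ge0 (`|h y| - 1); have := normr_ge0 (h y); nra.
Qed.

Lemma integrable_mul_of_sqr h k : measurable_fun setT h -> measurable_fun setT k ->
  mu.-integrable setT (EFin \o (fun x => h x * h x)) ->
  mu.-integrable setT (EFin \o (fun x => k x * k x)) ->
  mu.-integrable setT (EFin \o (fun x => h x * k x)).
Proof.
move=> mh mk ih ik.
apply: (le_integrable measurableT _ _ (integrableD measurableT ih ik)).
  by apply/measurable_EFinP; exact: measurable_funM.
move=> y _ /=; rewrite lee_fin.
rewrite [leRHS]ger0_norm; last by rewrite addr_ge0// -expr2 sqr_ge0.
rewrite ler_norml; apply/andP; split.
  have := sqr_ge0 (h y + k y); have := sqr_ge0 (h y - k y); nra.
have := sqr_ge0 (h y - k y); have := sqr_ge0 (h y + k y); nra.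
Qed.

(** Expanding the product gives twice the mean of [h * k] minus twice the
    product of the means, by independence of the two coordinates. *)
Lemma covariance_symmetrized h k :
  mu.-integrable setT (EFin \o h) -> mu.-integrable setT (EFin \o k) ->
  mu.-integrable setT (EFin \o (fun x => h x * k x)) ->
  Rintegral (mu \x mu)%E setT (fun w => (h w.2 - h w.1) * (k w.2 - k w.1)) =
  2 * cov mu h k.
Proof.
move=> ih ik ihk.
have i1 : mu.-integrable setT (EFin \o cst 1).
  exact: finite_measure_integrable_cst.
have E1 : Rintegral mu setT (cst 1) = 1.
  transitivity (1 * fine (mu setT)); first exact: Rintegral_cst.
  by rewrite probability_setT mul1r.
(* The constant factors display each term as a tensor product. *)
transitivity (Rintegral (mu \x mu)%E setT (fun w =>
  ((cst 1 w.1 * (h w.2 * k w.2) + (h w.1 * k w.1) * cst 1 w.2) -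
   (h w.1 * k w.2 + k w.1 * h w.2)))).
  by apply: eq_Rintegral => w _ /=; ring.
have Ia := integrable_tensor i1 ihk; have Ib := integrable_tensor ihk i1.
have Ic := integrable_tensor ih ik; have Id := integrable_tensor ik ih.
rewrite RintegralB//; last 2 first.
- exact: (integrableD measurableT Ia Ib).
- exact: (integrableD measurableT Ic Id).
rewrite !RintegralD//.
rewrite (Rintegral_tensor i1 ihk) (Rintegral_tensor ihk i1).
rewrite (Rintegral_tensor ih ik) (Rintegral_tensor ik ih) E1 /cov.
by ring.
Qed.

End square_integrable.

Section real_covariance.
Context {R : realType} (mu : probability (measurableTypeR R) R).
Notation T := (measurableTypeR R * measurableTypeR R)%type.
Notation leb := (@lebesgue_measure R).
Notation lam := (hoeffding_measure mu).

Definition primitive (f f' : R -> R) :=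
  forall a b : R, a <= b -> f b - f a = Rintegral leb `[a, b]%classic f'.

Lemma integrable_locally (f' : R -> R) a b : locally_integrable setT f' ->
  leb.-integrable `[a, b] (EFin \o f').
Proof.
move=> [mf _ lf]; apply/integrableP; split.
  by apply/measurable_EFinP; exact: measurable_funTS.
by apply: lf => //; exact: segment_compact.
Qed.

Lemma mul_jump_restrict (f' : R -> R) (w : T) :
  (fun x => f' x * jump w x) =
  (fun x => (if w.1 <= w.2 then 1 else -1) *
     (f' \_ `[Num.min w.1 w.2, Num.max w.1 w.2[) x).
Proof. by apply/funext => x; rewrite jumpE patch_indic/=; ring. Qed.

Lemma integrable_jump_restrict (f' : R -> R) (w : T) :
  locally_integrable setT f' ->
  leb.-integrable setT (EFin \o (f' \_ `[Num.min w.1 w.2, Num.max w.1 w.2[)).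
Proof.
move=> lf; rewrite -restrict_EFin.
have mi : measurable
    (`[Num.min w.1 w.2, Num.max w.1 w.2[%classic : set (measurableTypeR R)).
  exact: measurable_itv.
have [H _] := @integrable_mkcond _ (measurableTypeR R) R leb _ (EFin \o f') mi.
apply: H.
apply: integrableS (integrable_locally (Num.min w.1 w.2) (Num.max w.1 w.2) lf) => //.
exact: subset_itv_co_cc.
Qed.

Lemma integrable_jump (f' : R -> R) (w : T) : locally_integrable setT f' ->
  leb.-integrable setT (EFin \o (fun x => f' x * jump w x)).
Proof.
move=> lf; rewrite mul_jump_restrict.
apply: eq_integrable (integrableZl measurableT (if w.1 <= w.2 then 1 else -1)
  (integrable_jump_restrict w lf)) => // x _.
Qed.

Lemma Rintegral_jump (f f' : R -> R) (w : T) : locally_integrable setT f' ->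
  primitive f f' ->
  Rintegral leb setT (fun x => f' x * jump w x) = f w.2 - f w.1.
Proof.
move=> lf pf; rewrite mul_jump_restrict.
have ib : leb.-integrable `[Num.min w.1 w.2, Num.max w.1 w.2[ (EFin \o f').
  apply: integrableS (integrable_locally (Num.min w.1 w.2) (Num.max w.1 w.2) lf) => //.
  exact: subset_itv_co_cc.
rewrite RintegralZl//; last exact: integrable_jump_restrict.
rewrite -Rintegral_mkcond Rintegral_itv_bndo_bndc// -pf; last first.
  by rewrite ge_min le_max lexx.
by rewrite minEle maxEle; case: ifP => _; ring.
Qed.

(** For [g = f] the conclusion of [fubini_jump] includes integrability of the
    squared increment. *)
Lemma primitive_sqr_integrable (f f' : R -> R) :
  measurable_fun setT f -> locally_integrable setT f' -> primitive f f' ->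
  (\int[lam]_z (`|f' z.1| * `|f' z.2|)%:E < +oo)%E ->
  mu.-integrable setT (EFin \o (fun x => f x * f x)).
Proof.
move=> mf lf pf fin; apply: integrable_sqr_diff => //.
have mf' : measurable_fun setT f' by case: lf.
have [_ + _] := fubini_jump mf' mf' (fun w => integrable_jump w lf)
  (fun w => integrable_jump w lf) fin.
by apply: eq_integrable => // w _ /=; rewrite (Rintegral_jump _ lf pf).
Qed.

(** By [tonelli_jump] the mixed integral is half the mean of [I f' * I g'],
    where [I p w] is the integral of [|p| * |jump w|]; it is dominated by the
    means of the squares of [I f'] and [I g'], which are finite by the same
    formula. *)
Lemma hoeffding_cross_finite (f' g' : R -> R) :
  locally_integrable setT f' -> locally_integrable setT g' ->
  (\int[lam]_z (`|f' z.1| * `|f' z.2|)%:E < +oo)%E ->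
  (\int[lam]_z (`|g' z.1| * `|g' z.2|)%:E < +oo)%E ->
  (\int[lam]_z (`|f' z.1| * `|g' z.2|)%:E < +oo)%E.
Proof.
move=> lf lg ff fg.
have [mf' _ _] := lf; have [mg' _ _] := lg.
pose I (p : R -> R) (w : T) := (\int[leb]_x (`|p x| * `|jump w x|)%:E)%E.
have I0 p w : (0 <= I p w)%E.
  by apply: integral_ge0 => x _; rewrite lee_fin mulr_ge0.
have Ifin (p : R -> R) w : locally_integrable setT p -> I p w \is a fin_num.
  move=> lp; rewrite ge0_fin_numE//.
  have /integrableP[_] := integrable_jump w lp.
  by rewrite /I; under eq_integral do rewrite /= normrM.
have TJ (p q : R -> R) : measurable_fun setT p -> measurable_fun setT q ->
    (2%:E * \int[lam]_z (`|p z.1| * `|q z.2|)%:E =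
     \int[mu \x mu]_w (I p w * I q w))%E.
  move=> mp mq.
  have mnp : measurable_fun setT (fun x => `|p x|) by exact: measurableT_comp.
  have mnq : measurable_fun setT (fun x => `|q x|) by exact: measurableT_comp.
  by rewrite (tonelli_jump mu mnp mnq).
have mI (p : R -> R) : measurable_fun setT p -> measurable_fun setT (I p).
  move=> mp.
  apply: (measurable_fun_fubini_tonelli_G (m1 := leb)
    (fun xw : measurableTypeR R * T => (`|p xw.1| * `|jump xw.2 xw.1|)%:E)).
    apply/measurable_EFinP; apply: measurable_funM; apply: measurableT_comp => //.
      exact: (measurableT_comp mp (measurable_fst : measurable_fun _ _)).
    by apply: measurable_jump.
  by move=> xw; rewrite lee_fin mulr_ge0.
suff : (2%:E * \int[lam]_z (`|f' z.1| * `|g' z.2|)%:E < +oo)%E.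
  apply: le_lt_trans; rewrite -[leLHS]mul1e lee_pmul//.
    by apply: integral_ge0 => z _; rewrite lee_fin mulr_ge0.
  by rewrite lee_fin ler1n.
rewrite TJ//.
apply: (@le_lt_trans _ _ (\int[mu \x mu]_w (I f' w * I f' w + I g' w * I g' w))%E).
  apply: ge0_le_integral => //.
  - by move=> w _; rewrite mule_ge0.
  - by apply: emeasurable_funM; exact: mI.
  - by apply: emeasurable_funD; apply: emeasurable_funM; exact: mI.
  move=> w _; rewrite -(fineK (Ifin f' w lf)) -(fineK (Ifin g' w lg)).
  rewrite -!EFinM -EFinD lee_fin.
  set a := fine _; set b := fine _.
  have := sqr_ge0 (a - b); have := sqr_ge0 (a + b); nra.
rewrite ge0_integralD//; first last.
- by apply: emeasurable_funM; exact: mI.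
- by move=> w _; rewrite mule_ge0.
- by apply: emeasurable_funM; exact: mI.
- by move=> w _; rewrite mule_ge0.
rewrite -!TJ// lte_add_pinfty//; apply: lte_mul_pinfty => //.
Qed.

Theorem real_covariance_identity (f g f' g' : R -> R) :
  measurable_fun setT f -> measurable_fun setT g ->
  locally_integrable setT f' -> locally_integrable setT g' ->
  primitive f f' -> primitive g g' ->
  (\int[lam]_z (`|f' z.1| * `|f' z.2|)%:E < +oo)%E ->
  (\int[lam]_z (`|g' z.1| * `|g' z.2|)%:E < +oo)%E ->
  [/\ mu.-integrable setT (EFin \o f), mu.-integrable setT (EFin \o g),
      mu.-integrable setT (EFin \o (fun x => f x * g x)),
      lam.-integrable setT (EFin \o (fun z => f' z.1 * g' z.2))
    & cov mu f g = Rintegral lam setT (fun z => f' z.1 * g' z.2)].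
Proof.
move=> mf mg lf lg pf pg ff fg.
have [mf' _ _] := lf; have [mg' _ _] := lg.
have f2 := primitive_sqr_integrable mf lf pf ff.
have g2 := primitive_sqr_integrable mg lg pg fg.
have i1 := integrable_of_sqr mf f2; have i2 := integrable_of_sqr mg g2.
have i12 := integrable_mul_of_sqr mf mg f2 g2.
have [il _ E] := fubini_jump mf' mg' (fun w => integrable_jump w lf)
  (fun w => integrable_jump w lg) (hoeffding_cross_finite lf lg ff fg).
split => //.
apply: (@mulfI _ (2 : R)); first by rewrite pnatr_eq0.
rewrite -(covariance_symmetrized i1 i2 i12) -E.
apply: eq_Rintegral => w _.
by rewrite (Rintegral_jump _ lf pf) (Rintegral_jump _ lg pg).
Qed.

End real_covariance.

(** * Smooth bumps *)

Section bump.
Context {R : realType}.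
Implicit Types f g : R -> R.

(** Finite-order differentiability peeled from the first derivative, unlike the
    iterated derivative in [smooth]: in this form the stability properties
    below follow by induction on the order. *)
Fixpoint iter_derivable (n : nat) f : Prop :=
  (forall x, derivable f x 1) /\
  (if n is m.+1 then iter_derivable m (derive1 f) else True).

Lemma iter_derivable_smooth f : (forall n, iter_derivable n f) -> smooth f.
Proof.
move=> H n; elim: n f H => [|n IH] f H x; first by have [] := H 0%N.
rewrite derive1Sn; apply: IH => m; by have [] := H m.+1.
Qed.

Lemma iter_derivable_pred n f : iter_derivable n.+1 f -> iter_derivable n f.
Proof.
elim: n f => [|n IH] f [df H]; first by split.
by split => //; apply: IH.
Qed.

Lemma iter_derivableD n f g :
  iter_derivable n f -> iter_derivable n g -> iter_derivable n (f \+ g).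
Proof.
elim: n f g => [|n IH] f g [df Hf] [dg Hg]; split.
- by move=> x; apply: derivableD.
- exact: Logic.I.
- by move=> x; apply: derivableD.
rewrite (_ : derive1 _ = derive1 f \+ derive1 g); first exact: IH.
by apply/funext => x; rewrite /= !derive1E deriveD.
Qed.

Lemma iter_derivableM n f g :
  iter_derivable n f -> iter_derivable n g -> iter_derivable n (f \* g).
Proof.
elim: n f g => [|n IH] f g Hf Hg; have [df Hf'] := Hf; have [dg Hg'] := Hg; split.
- by move=> x; apply: derivableM.
- exact: Logic.I.
- by move=> x; apply: derivableM.
rewrite (_ : derive1 _ = (f \* derive1 g) \+ (g \* derive1 f)); last first.
  by apply/funext => x; rewrite /= !derive1E deriveM.
by apply: iter_derivableD; apply: IH => //; exact: iter_derivable_pred.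
Qed.

Lemma iter_derivable_cst n c : iter_derivable n (cst c : R -> R).
Proof.
elim: n c => [|n IH] c; split => //.
rewrite (_ : derive1 _ = cst 0) //; apply/funext => x.
by rewrite derive1E derive_cst.
Qed.

Lemma iter_derivable_affine n f c d :
  iter_derivable n f -> iter_derivable n (fun x => f (c * x + d)).
Proof.
have D (h : R -> R) x : derivable h (c * x + d) 1 ->
    is_derive x 1 (fun y => h (c * y + d)) (derive1 h (c * x + d) * c).
  move=> dh; rewrite -[X in is_derive _ _ X]/(h \o (fun y => c * y + d)).
  apply: is_derive1_comp; first by rewrite derive1E; exact: derivableP.
  by apply: is_derive_eq; rewrite addr0 /GRing.scale/= mulr1.
elim: n f => [|n IH] f [df Hf]; split.
- by move=> x; have [] := D _ x (df _).
- exact: Logic.I.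
- by move=> x; have [] := D _ x (df _).
rewrite (_ : derive1 _ = (fun x => derive1 f (c * x + d)) \* (cst c)); last first.
  by apply/funext => x /=; rewrite derive1E; apply: derive_val; exact: D.
by apply: iter_derivableM; [exact: IH|exact: iter_derivable_cst].
Qed.

(** The derivatives of [exp (- 1 / x)], extended by zero, are combinations of
    the functions [flat k]; with this family smoothness is a closure property
    under differentiation. *)
Definition flat k (x : R) := if 0 < x then x^-1 ^+ k * expR (- x^-1) else 0.

Lemma flat_ge0 k x : 0 <= flat k x.
Proof.
rewrite /flat; case: ltP => // x0.
by rewrite mulr_ge0 ?expR_ge0// exprn_ge0// invr_ge0 ltW.
Qed.

(** The exponential series gives [exp y >= y ^ (k + 1) / (k + 1)!] with
    [y = 1 / x].  The linear bound for the index [k + 1] makes the difference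
    quotient of [flat k] at the origin tend to zero. *)
Lemma flat_le k x : flat k x <= k.+1`!%:R * `|x|.
Proof.
rewrite /flat; case: ltP => [x0|_]; last by rewrite mulr_ge0.
have y0 : 0 < x^-1 by rewrite invr_gt0.
have := expR_ge1Dxn k (ltW y0) => h.
rewrite expRN ler_pdivrMr ?expR_gt0// gtr0_norm//.
have F0 : (0 < k.+1`!%:R :> R) by rewrite ltr0n fact_gt0.
rewrite -ler_pdivrMl; last by rewrite mulr_gt0.
rewrite invfM mulrAC -mulrA -exprSr.
by apply: le_trans h; rewrite mulrC lerDr.
Qed.

Lemma is_derive_flat k (x : R) :
  is_derive x 1 (flat k) (flat k.+2 x - k%:R * flat k.+1 x).
Proof.
have [x0|x0|xlt] := ltgtP x 0.
- rewrite /flat !(lt_gtF x0) mulr0 subrr.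
  apply: (@near_eq_is_derive _ _ _ (cst 0)) => //.
  near=> y; rewrite /flat/= ifF//; apply/negbTE; rewrite -leNgt ltW//.
  by near: y; exact: lt_nbhsl.
- rewrite /flat x0.
  apply: (@near_eq_is_derive _ _ _ (fun y : R => y^-1 ^+ k * expR (- y^-1))).
    near=> y; rewrite /flat/= ifT//.
    by near: y; exact: lt_nbhsr.
  have xn0 : x != 0 by rewrite gt_eqF.
  have dV : is_derive x 1 (fun y : R => y^-1) (- x ^- 2 *: 1) by exact: is_deriveV.
  have dX : is_derive x 1 (fun y : R => y^-1 ^+ k)
      ((k%:R * x^-1 ^+ k.-1) *: (- x ^- 2 *: 1)).
    by have := is_deriveX k dV; rewrite exprfctE.
  have dE : is_derive x 1 (fun y : R => expR (- y^-1))
      (expR (- x^-1) * (- (- x ^- 2 *: 1))).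
    exact: is_derive1_comp.
  apply: (is_derive_eq (is_deriveM dX dE)).
  rewrite /GRing.scale/= !mulr1 -!exprVn.
  by case: k {dX} => [|k]/=; rewrite !(exprS, expr0); ring.
  (* At the origin the difference quotient of [flat k] is [flat k.+1]. *)
- rewrite xlt; rewrite {2 3}/flat ltxx mulr0 subrr.
  have cv : (fun h => h^-1 *: ((flat k \o shift 0) (h *: (1 : R)) - flat k 0))
      @ 0^' --> (0 : R).
    apply/cvgrPdist_le => e e0.
    near=> h.
    have h0 : h != 0 by near: h; exact: nbhs_dnbhs_neq.
    rewrite sub0r normrN /= /GRing.scale/= mulr1 addr0 {2}/flat ltxx subr0.
    have -> : h^-1 * flat k h = flat k.+1 h.
      rewrite /flat; case: ifP => _; last by rewrite mulr0.
      by rewrite mulrA -exprS.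
    rewrite ger0_norm ?flat_ge0//; apply: le_trans (flat_le _ _) _.
    have F0 : (0 < k.+2`!%:R :> R) by rewrite ltr0n fact_gt0.
    rewrite -ler_pdivlMl// mulrC.
    near: h; apply: dnbhs0_le; exact: divr_gt0.
  apply: DeriveDef; last exact: cvg_lim cv.
  by apply/cvg_ex; exists 0.
Unshelve. all: end_near. Qed.

Lemma iter_derivable_flat n k : iter_derivable n (flat k).
Proof.
elim: n k => [|n IH] k; split.
- by move=> x; have [] := is_derive_flat k x.
- exact: Logic.I.
- by move=> x; have [] := is_derive_flat k x.
rewrite (_ : derive1 _ = flat k.+2 \+ (cst (- k%:R) \* flat k.+1)).
  apply: iter_derivableD => //; apply: iter_derivableM => //.
  exact: iter_derivable_cst.
apply/funext => x /=; rewrite derive1E mulNr; apply: derive_val.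
exact: is_derive_flat.
Qed.

(** Rescaling the argument of [exp (- 1 / x)] by [n + 1] takes the
    [(n + 1)]-th root of the function, so these bumps increase with [n] to the
    indicator of [`]a, b[] while keeping their support. *)
Definition bumpf (a b : R) (n : nat) (x : R) : R :=
  flat 0 (n.+1%:R * (x - a)) * flat 0 (n.+1%:R * (b - x)).

Lemma smooth_bump a b n : smooth (bumpf a b n).
Proof.
apply: iter_derivable_smooth => m.
rewrite (_ : bumpf a b n =
  (fun x => flat 0 (n.+1%:R * x + (- (n.+1%:R * a)))) \*
  (fun x => flat 0 (- n.+1%:R * x + n.+1%:R * b))).
  by apply: iter_derivableM; apply: iter_derivable_affine; exact: iter_derivable_flat.
by apply/funext => x; rewrite /bumpf/=; congr (flat _ _ * flat _ _); ring.
Qed.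

Lemma flat0_le1 x : flat 0 x <= 1.
Proof.
rewrite /flat; case: ltP => // x0.
by rewrite expr0 mul1r expR_le1 oppr_le0 invr_ge0 ltW.
Qed.

Lemma bump_ge0 a b n x : 0 <= bumpf a b n x.
Proof. by rewrite mulr_ge0// flat_ge0. Qed.

Lemma bump_le1 a b n x : bumpf a b n x <= 1.
Proof. by rewrite mulr_ile1 ?flat_ge0 ?flat0_le1. Qed.

Lemma bump_out a b n x : ~ `]a, b[%classic x -> bumpf a b n x = 0.
Proof.
rewrite /= in_itv/= /bumpf /flat => /negP; rewrite negb_and -!leNgt.
have n0 : (0 < n.+1%:R :> R) by rewrite ltr0n.
case/orP => h.
  by rewrite ifF ?mul0r// pmulr_rgt0// subr_gt0 ltNge h.
by rewrite [X in _ * X]ifF ?mulr0// pmulr_rgt0// subr_gt0 ltNge h.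
Qed.

Lemma bumpE a b n x : `]a, b[%classic x ->
  bumpf a b n x = expR (- (((x - a)^-1 + (b - x)^-1) / n.+1%:R)).
Proof.
rewrite /= in_itv/= => /andP[ax xb]; rewrite /bumpf /flat.
have n0 : (0 < n.+1%:R :> R) by rewrite ltr0n.
rewrite !pmulr_rgt0// !subr_gt0 ax xb !expr0 !mul1r -expRD; congr expR.
by rewrite !invfM; ring.
Qed.

Lemma bump_nd a b x : nondecreasing_seq (fun n => bumpf a b n x).
Proof.
move=> m n mn.
have [xab|xab] := pselect (`]a, b[%classic x); last by rewrite !bump_out.
rewrite !bumpE// ler_expR lerN2.
have /andP[ax xb] : a < x < b by move: xab; rewrite /= in_itv.
apply: ler_wpM2l.
  by rewrite addr_ge0// invr_ge0 subr_ge0 ltW.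
by rewrite lef_pV2 ?posrE ?ltr0n// ler_nat.
Qed.

Lemma bump_cvg a b x : bumpf a b n x @[n --> \oo] --> (\1_(`]a, b[%classic) x : R).
Proof.
rewrite indicE; have [xab|xab] := pselect (`]a, b[%classic x); last first.
  rewrite memNset//.
  rewrite (_ : (fun n => _) = cst 0); first exact: cvg_cst.
  by apply/funext => n; rewrite bump_out.
rewrite mem_set//.
rewrite (_ : (fun n => _) =
  (fun n => expR (- (((x - a)^-1 + (b - x)^-1) * n.+1%:R^-1)))); last first.
  by apply/funext => n; rewrite bumpE.
have c0 : - (((x - a)^-1 + (b - x)^-1) * n.+1%:R^-1) @[n --> \oo] --> (0 : R).
  rewrite -[X in _ --> X]oppr0; apply: cvgN.
  rewrite -[X in _ --> X](mulr0 ((x - a)^-1 + (b - x)^-1)).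
  by apply: cvgMl_tmp; exact: cvg_harmonic.
have := continuous_cvg _ (@continuous_expR R 0) c0.
by rewrite expR0; apply.
Qed.

Lemma smooth_continuous f : smooth f -> continuous f.
Proof.
move=> sf x; apply: differentiable_continuous; apply/derivable1_diffP.
exact: (sf 0%N).
Qed.

Lemma bump_support a b n : closure [set x | bumpf a b n x != 0] `<=` `[a, b].
Proof.
have cl : closed (`[a, b]%classic : set R) by exact: interval_closed.
rewrite closureE => x; apply; split => // y /= /eqP by0.
have [yab|yab] := pselect (`]a, b[%classic y); last by rewrite bump_out in by0.
exact: subset_itv_oo_cc yab.
Qed.

Lemma bump_integrable a b n :
  lebesgue_measure.-integrable setT (EFin \o bumpf a b n).
Proof.
apply: (le_integrable measurableT _ _ (@integrable_indic_itv _ a b true false)).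
- apply/measurable_EFinP; apply: continuous_measurable_fun.
  exact/smooth_continuous/smooth_bump.
- move=> x _ /=; rewrite lee_fin indicE.
  rewrite ger0_norm ?bump_ge0//.
  have [xab|xab] := pselect (`[a, b]%classic x).
    by rewrite mem_set// normr1 bump_le1.
  rewrite memNset// bump_out ?normr0// => h; apply: xab; exact: subset_itv_oo_cc h.
Qed.

(** Products of bumps are thus products of derivatives of admissible test
    functions. *)
Lemma bump_primitive a b n :
  exists2 u : R -> R, Cb_infty u & derive1 u = bumpf a b n.
Proof.
(* Starting the integral at minus infinity makes [u] a primitive everywhere. *)
pose u x := Rintegral lebesgue_measure `]-oo, x] (bumpf a b n).
have D x : derivable u x 1 /\ (derive1 u) x = bumpf a b n x.
  apply: (@continuous_FTC1 _ (bumpf a b n) -oo%O x (x + 1)) => //.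
  - by rewrite ltrDl.
  - apply: (integrableS measurableT) => //; exact: bump_integrable.
  - by rewrite ltNyr.
  - exact: (smooth_continuous (@smooth_bump a b n)).
have E : derive1 u = bumpf a b n by apply/funext => x; have [] := D x.
exists u => //; split.
- by move=> x; have [] := D x.
- by rewrite E; exact: smooth_bump.
- rewrite /compactly_supported E.
  apply: (subclosed_compact _ (@segment_compact R a b)); first exact: closed_closure.
  exact: bump_support.
Qed.

End bump.

(** * Uniqueness from products of bumps *)

Section uniqueness.
Context {R : realType}.
Notation T := (measurableTypeR R * measurableTypeR R)%type.

Definition open_rectangles : set (set T) :=
  [set A | exists a b c d : R, A = `]a, b[%classic `*` `]c, d[%classic].

Lemma bigcup_itvoo : \bigcup_n `]- n%:R, n%:R[%classic = [set: R].
Proof.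
apply/seteqP; split => // x _.
exists (Num.truncn `|x|).+1 => //=.
by rewrite in_itv/= -ltr_norml truncnS_gt.
Qed.

(** Both projections are measurable for the sigma-algebra on the right, since a
    strip over an open interval is a countable union of open rectangles. *)
Lemma open_rectangles_generate : @measurable _ T = <<s open_rectangles >>.
Proof.
apply/seteqP; split; last first.
  apply: smallest_sub; first exact: sigma_algebra_measurable.
  by move=> _ [a [b [c [d ->]]]]; apply: measurableX.
pose G := g_sigma_algebraType open_rectangles.
have m1 : measurable_fun [set: G] (fst : G -> measurableTypeR R).
  apply: (measurability _ (RGenOpens.measurableE R)).
  move=> _ [_ [a [b ->]] <-]; rewrite setTI.
  rewrite -[X in measurable X]setXT -bigcup_itvoo setX_bigcupr.
  apply: bigcup_measurable => k _; apply: sub_sigma_algebra.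
  by exists a, b, (- k%:R), k%:R.
have m2 : measurable_fun [set: G] (snd : G -> measurableTypeR R).
  apply: (measurability _ (RGenOpens.measurableE R)).
  move=> _ [_ [a [b ->]] <-]; rewrite setTI.
  rewrite -[X in measurable X]setTX -bigcup_itvoo setX_bigcupl.
  apply: bigcup_measurable => k _; apply: sub_sigma_algebra.
  by exists (- k%:R), k%:R, a, b.
apply: smallest_sub; first exact: smallest_sigma_algebra.
by move=> _ [] [A mA <-]; [exact: m1|exact: m2].
Qed.

Lemma locally_finite_rectangle (lam : {measure set T -> \bar R}) (a b c d : R) :
  locally_finite lam -> (lam (`[a, b]%classic `*` `[c, d]%classic) < +oo)%E.
Proof.
by apply; apply: compact_setX; exact: segment_compact.
Qed.

Lemma indic_setX (A B : set R) (z : T) :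
  \1_(A `*` B) z = \1_A z.1 * \1_B z.2 :> R.
Proof. by rewrite !indicE in_setX -natrM mulnb. Qed.

Lemma measurable_bumpf (a b : R) n : measurable_fun setT (bumpf a b n).
Proof.
by apply: continuous_measurable_fun; exact/smooth_continuous/smooth_bump.
Qed.

Lemma measurable_bumpf2 (a b c d : R) n :
  measurable_fun [set: T] (fun z => (bumpf a b n z.1 * bumpf c d n z.2)%:E).
Proof.
by apply/measurable_EFinP; apply: measurable_tensor; exact: measurable_bumpf.
Qed.

Lemma bump_rectangle_cvg (lam : {measure set T -> \bar R}) (a b c d : R) :
  (\int[lam]_z (bumpf a b n z.1 * bumpf c d n z.2)%:E)%E @[n --> \oo] -->
  lam (`]a, b[%classic `*` `]c, d[%classic).
Proof.
have mR : measurable (`]a, b[%classic `*` `]c, d[%classic : set T).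
  exact: measurableX.
rewrite -[X in lam X]setIT -integral_indic//.
rewrite [X in _ --> X](_ : _ = (\int[lam]_z
    limn (fun n => (bumpf a b n z.1 * bumpf c d n z.2)%:E))%E); last first.
  apply: eq_integral => z _; apply/esym/cvg_lim => //.
  rewrite indic_setX; apply: cvg_EFin.
    by apply: nearW.
  by apply: cvgM; exact: bump_cvg.
apply: cvg_monotone_convergence => //.
- by move=> n; exact: measurable_bumpf2.
- by move=> n z _; rewrite lee_fin mulr_ge0 ?bump_ge0.
- move=> z _ m n mn; rewrite lee_fin ler_pM ?bump_ge0//; exact: bump_nd.
Qed.

Lemma integral_bump_fin_num (lam : {measure set T -> \bar R}) (a b c d : R) n :
  locally_finite lam ->
  (\int[lam]_z (bumpf a b n z.1 * bumpf c d n z.2)%:E)%E \is a fin_num.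
Proof.
move=> flam; rewrite ge0_fin_numE; last first.
  by apply: integral_ge0 => z _; rewrite lee_fin mulr_ge0 ?bump_ge0.
apply: le_lt_trans (locally_finite_rectangle a b c d flam).
(* The product of bumps is at most the indicator of the closed rectangle. *)
rewrite -[X in lam X]setIT -integral_indic//; last exact: measurableX.
apply: ge0_le_integral => //.
- by move=> z _; rewrite lee_fin mulr_ge0 ?bump_ge0.
- exact: measurable_bumpf2.
- by apply/measurable_EFinP; apply: measurable_indic; exact: measurableX.
move=> z _; rewrite lee_fin indic_setX.
have le1 (a' b' x : R) n' : bumpf a' b' n' x <= \1_(`[a', b']%classic) x.
  have [xab|xab] := pselect (`]a', b'[%classic x).
    by rewrite indicE mem_set ?bump_le1//; exact: subset_itv_oo_cc.
  by rewrite bump_out.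
by apply: ler_pM; rewrite ?bump_ge0.
Qed.

(** The two measures agree on open rectangles as limits of the same integrals;
    local finiteness ensures that equality of the real-valued integrals is
    equality of the extended ones, and that the exhausting squares have finite
    measure. *)
Lemma measure_eq_bump (lam1 lam2 : {measure set T -> \bar R}) :
  locally_finite lam1 -> locally_finite lam2 ->
  (forall a b c d n,
    Rintegral lam1 setT (fun z => bumpf a b n z.1 * bumpf c d n z.2) =
    Rintegral lam2 setT (fun z => bumpf a b n z.1 * bumpf c d n z.2)) ->
  forall A, measurable A -> lam1 A = lam2 A.
Proof.
move=> f1 f2 E A mA.
have R12 a b c d : lam1 (`]a, b[%classic `*` `]c, d[%classic) =
    lam2 (`]a, b[%classic `*` `]c, d[%classic).
  have C1 := @bump_rectangle_cvg lam1 a b c d.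
  have C2 := @bump_rectangle_cvg lam2 a b c d.
  rewrite -(cvg_lim _ C1)// -(cvg_lim _ C2)//; congr (limn _).
  apply/funext => n.
  rewrite -[LHS]fineK ?integral_bump_fin_num//.
  rewrite -[RHS]fineK ?integral_bump_fin_num//.
  by congr EFin; exact: E.
apply: (measure_unique open_rectangles
  (fun n => `]- n%:R, n%:R[%classic `*` `]- n%:R, n%:R[%classic)) => //.
- exact: open_rectangles_generate.
- move=> _ _ [a [b [c [d ->]]]] [a' [b' [c' [d' ->]]]].
  rewrite -setXI.
  exists (Num.max a a'), (Num.min b b'), (Num.max c c'), (Num.min d d').
  have I (s t s' t' : R) : `]s, t[ `&` `]s', t'[ =
      `]Num.max s s', Num.min t t'[%classic.
    apply/seteqP; split => x /=; rewrite !in_itv/= gt_max lt_min.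
      by move=> [/andP[-> ->] /andP[-> ->]].
    by move=> /andP[/andP[-> ->] /andP[-> ->]].
  by rewrite !I.
- by move=> n; exists (- n%:R), n%:R, (- n%:R), n%:R.
- apply/seteqP; split => // -[x y] _.
  exists (Num.truncn (Num.max `|x| `|y|)).+1 => //=.
  have := truncnS_gt (Num.max `|x| `|y|); rewrite gt_max => /andP[hx hy].
  by rewrite !in_itv/= -!ltr_norml.
- by move=> _ [a [b [c [d ->]]]]; exact: R12.
- move=> n; apply: le_lt_trans (locally_finite_rectangle (- n%:R) n%:R (- n%:R) n%:R f1).
  apply: le_measure; rewrite ?inE; try exact: measurableX.
  by apply: setSX; exact: subset_itv_oo_cc.
Qed.

End uniqueness.

(** * Smooth test functions *)

(** Stated for arbitrary sets so that it applies to a compact set of the plane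
    without checking its measurability in the product structure; the integral
    of a nonnegative function is a supremum over simple functions below it. *)
Lemma ge0_integral_subset d (S : measurableType d) (R : realType)
    (m : {measure set S -> \bar R}) (A B : set S) (f : S -> \bar R) :
  (forall x, 0 <= f x)%E -> A `<=` B ->
  (\int[m]_(x in A) f x <= \int[m]_(x in B) f x)%E.
Proof.
move=> f0 AB; rewrite !ge0_integralE//.
apply: ereal_sup_le => _ [h /= hA <-]; exists h => // x.
apply: le_trans (hA x) _; rewrite /patch.
case: ifPn => [/set_mem Ax|_]; first by rewrite mem_set//; exact: AB.
by case: ifP.
Qed.

Section smooth_case.
Context {R : realType} (mu : probability (measurableTypeR R) R).
Notation T := (measurableTypeR R * measurableTypeR R)%type.
Notation leb := (@lebesgue_measure R).
Notation lam := (hoeffding_measure mu).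

Lemma compact_sub_square (K : set (R * R)) : compact K ->
  exists M : R, K `<=` `[- M, M]%classic `*` `[- M, M]%classic.
Proof.
move=> /compact_bounded[N [_ N1]].
exists (`|N| + 1) => -[x y] Kxy.
have /= := N1 (`|N| + 1) _ (x, y) Kxy.
rewrite ltr_pwDr// ?ler_norm// => /(_ isT).
rewrite prod_normE/= ge_max => /andP[hx hy].
by rewrite !in_itv/= -!ler_norml.
Qed.

Lemma hoeffding_kernel_le1 x y : hoeffding_kernel mu x y <= 1.
Proof.
rewrite mulr_ile1 ?distr_fun_ge0 ?distr_fun_le1 ?subr_ge0 ?distr_fun_le1//.
by rewrite gerBl distr_fun_ge0.
Qed.

(** The kernel is at most one, and a compact set lies in a bounded square. *)
Lemma hoeffding_locally_finite : locally_finite lam.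
Proof.
move=> K /compact_sub_square[M KM].
have mM : measurable (`[- M, M]%classic : set (measurableTypeR R)) by [].
set B := (X in K `<=` X) in KM.
have mB : measurable (B : set T) by exact: measurableX.
have le1 : (lam K <= \int[leb \x leb]_(z in B)
   (hoeffding_kernel mu z.1 z.2)%:E)%E.
  apply: ge0_integral_subset => // z; rewrite lee_fin.
  exact: hoeffding_kernel_ge0.
apply: (le_lt_trans le1) => {le1}.
apply: (@le_lt_trans _ _ (\int[leb \x leb]_(z in B) 1)%E).
  apply: ge0_le_integral => //.
  - by move=> z _; rewrite lee_fin hoeffding_kernel_ge0.
  - apply/measurable_EFinP/measurable_funTS; exact: measurable_hoeffding_kernel.
  - by move=> z _; rewrite lee_fin hoeffding_kernel_le1.
rewrite integral_cst//.
pose I : set (measurableTypeR R) := `[- M, M]%classic.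
have BE : (leb \x leb)%E B = (leb I * leb I)%E by exact: product_measure1E.
have fM : leb I \is a fin_num.
  by rewrite ge0_fin_numE// compact_finite_measure//; exact: segment_compact.
suff : (leb I * leb I < +oo)%E by rewrite -BE mul1e.
by rewrite -(fineK fM) -EFinM ltry.
Qed.

Lemma continuous_locally_integrable (f : R -> R) : continuous f ->
  locally_integrable setT f.
Proof.
move=> cf; split.
- exact: continuous_measurable_fun.
- exact: openT.
- move=> K _ cK.
  have /integrableP[_] := @continuous_compact_integrable R f K cK
    (continuous_subspaceT cf).
  by [].
Qed.

Lemma derivable_primitive (u : R -> R) : (forall x, derivable u x 1) ->
  continuous (derive1 u) -> primitive u (derive1 u).
Proof.
move=> du cu a b; rewrite le_eqVlt => /predU1P[<-|ab].
  by rewrite subrr set_itv1 Rintegral_set1.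
rewrite /Rintegral (@continuous_FTC2 _ (derive1 u) u a b ab)//.
  exact: continuous_subspaceT.
have cont x : {for x, continuous u}.
  by apply: differentiable_continuous; exact/derivable1_diffP.
split => //.
- by apply: cvg_at_right_filter; exact: cont.
- by apply: cvg_at_left_filter; exact: cont.
Qed.

Lemma compactly_supported_finite (f : R -> R) : continuous f ->
  compactly_supported f ->
  (\int[lam]_z (`|f z.1| * `|f z.2|)%:E < +oo)%E.
Proof.
move=> cf sf.
have mf : measurable_fun setT f by exact: continuous_measurable_fun.
rewrite /compactly_supported in sf; set S := closure _ in sf.
have [N [_ /(_ (`|N| + 1))bN]] := compact_bounded sf.
have [M [_ /(_ (`|M| + 1))bM]] := compact_bounded
  (continuous_compact (continuous_subspaceT cf) sf).
rewrite ltr_pwDr ?ler_norm// in bN; rewrite ltr_pwDr ?ler_norm// in bM.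
have m0 : 0 <= `|M| + 1 by rewrite addr_ge0.
move: (`|N| + 1) (`|M| + 1) m0 bN bM => n m m0 /(_ isT) bN /(_ isT) bM.
have fle x : `|f x| <= m * \1_(`[- n, n]%classic) x.
  have [->|fx0] := eqVneq (f x) 0; first by rewrite normr0 mulr_ge0// indicE.
  have Sx : S x by apply: subset_closure.
  rewrite indicE mem_set ?mulr1; first by apply: bM; exists x.
  by rewrite /= in_itv/= -ler_norml; exact: bN.
have mn : measurable (`[- n, n]%classic : set (measurableTypeR R)) by [].
have mnn := measurableX mn mn.
apply: (@le_lt_trans _ _ (\int[lam]_z ((m * m)%:E *
    (\1_(`[- n, n]%classic `*` `[- n, n]%classic) z)%:E))%E).
  apply: ge0_le_integral => //.
  - have mnf : measurable_fun setT (fun x => `|f x|) by exact: measurableT_comp.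
    by apply/measurable_EFinP; exact: (measurable_tensor mnf mnf).
  - apply/measurable_EFinP; apply: measurable_funM => //; exact: measurable_indic.
  move=> z _; rewrite lee_fin indic_setX mulrACA.
  by apply: ler_pM.
rewrite ge0_integralZl//; last 2 first.
- by apply/measurable_EFinP; exact: measurable_indic.
- by rewrite lee_fin -expr2 sqr_ge0.
rewrite integral_indic// setIT; apply: lte_mul_pinfty => //.
  by rewrite lee_fin -expr2 sqr_ge0.
by apply: (locally_finite_rectangle _ _ _ _ hoeffding_locally_finite).
Qed.

Lemma Cb_infty_covariance (u v : R -> R) : Cb_infty u -> Cb_infty v ->
  covariance_identity mu lam u v.
Proof.
move=> [du su csu] [dv sv csv].
have cu := smooth_continuous su; have cv := smooth_continuous sv.
have mD (w : R -> R) : (forall x, derivable w x 1) -> measurable_fun setT w.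
  move=> dw; apply: continuous_measurable_fun => x.
  by apply: differentiable_continuous; exact/derivable1_diffP.
have [] // := real_covariance_identity (mD _ du) (mD _ dv)
  (continuous_locally_integrable cu) (continuous_locally_integrable cv)
  (derivable_primitive du cu) (derivable_primitive dv cv)
  (compactly_supported_finite cu csu) (compactly_supported_finite cv csv).
Qed.

Lemma hoeffding_measure_unique
    (l : {measure set T -> \bar R}) : locally_finite l ->
  (forall u v : R -> R, Cb_infty u -> Cb_infty v -> covariance_identity mu l u v) ->
  forall A, measurable A -> l A = lam A.
Proof.
move=> fl cl; apply: measure_eq_bump => //; first exact: hoeffding_locally_finite.
move=> a b c d n.
have [u Cu <-] := bump_primitive a b n; have [v Cv <-] := bump_primitive c d n.
by rewrite -(cl _ _ Cu Cv) -(Cb_infty_covariance Cu Cv).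
Qed.

End smooth_case.

(** * Complex functions *)

Section complex_case.
Context {R : realType} (mu : probability (measurableTypeR R) R).
Notation T := (measurableTypeR R * measurableTypeR R)%type.
Notation leb := (@lebesgue_measure R).
Notation lam := (hoeffding_measure mu).
Notation Re := complex.Re.
Notation Im := complex.Im.

Lemma Re_le_normc (z : R[i]) : `|Re z| <= normc z.
Proof.
by case: z => a b /=; rewrite -sqrtr_sqr ler_wsqrtr// lerDl sqr_ge0.
Qed.

Lemma Im_le_normc (z : R[i]) : `|Im z| <= normc z.
Proof.
by case: z => a b /=; rewrite -sqrtr_sqr ler_wsqrtr// lerDr sqr_ge0.
Qed.

Lemma ReB (z w : R[i]) : Re (z - w) = Re z - Re w.
Proof. by case: z => a b; case: w => c d. Qed.

Lemma ImB (z w : R[i]) : Im (z - w) = Im z - Im w.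
Proof. by case: z => a b; case: w => c d. Qed.

Lemma ReM (z w : R[i]) : Re (z * w) = Re z * Re w - Im z * Im w.
Proof. by case: z => a b; case: w => c d. Qed.

Lemma ImM (z w : R[i]) : Im (z * w) = Re z * Im w + Im z * Re w.
Proof. by case: z => a b; case: w => c d. Qed.

(** Absolute continuity with a single interval is uniform continuity. *)
Lemma locally_AC_continuous (p : R[i] -> R) (u : R -> R[i]) :
  (forall z w, `|p z - p w| <= normc (z - w)) ->
  locally_absolutely_continuous u -> continuous (p \o u).
Proof.
move=> ple acu x; apply/cvgrPdist_lt => e e0.
have [d d0 H] := acu (x - 1) (x + 1) e e0.
have m0 : 0 < Num.min d 1 by rewrite lt_min d0 ltr01.
near=> y.
have xy : `|x - y| < Num.min d 1 by near: y; exact: cvgr_dist_lt.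
move: xy; rewrite lt_min => /andP[xyd xy1].
have := H 1%N (fun=> Num.min x y) (fun=> Num.max x y).
rewrite !big_ord1 => HH.
apply: le_lt_trans (HH _ _ _).
- by rewrite minEle maxEle; case: ifP => _; [rewrite distrC|]; exact: ple.
- move: xy1; rewrite ltr_norml => /andP[h1 h2] _; split.
  + by rewrite le_min; apply/andP; split; lra.
  + by rewrite ge_min le_max lexx.
  + by rewrite ge_max; apply/andP; split; lra.
- by move=> i j _ _ _; rewrite !ord1.
- move: xyd; rewrite ltr_norml => /andP[h1 h2].
  by rewrite minEle maxEle; case: ifP => _; lra.
Unshelve. all: end_near. Qed.

(** The parameter [p] covers the real and the imaginary part at once; both are
    bounded by the modulus, so the hypotheses of the real case are inherited. *)
Lemma complex_components (p : R[i] -> R) (u u' : R -> R[i]) :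
  (p = @Re R \/ p = @Im R) ->
  locally_absolutely_continuous u -> radon_nikodym_derivative u u' ->
  (\int[lam]_z (normc (u' z.1) * normc (u' z.2))%:E < +oo)%E ->
  [/\ measurable_fun setT (p \o u), locally_integrable setT (p \o u'),
      primitive (p \o u) (p \o u') &
      (\int[lam]_z (`|p (u' z.1)| * `|p (u' z.2)|)%:E < +oo)%E].
Proof.
move=> pRI acu [lRe lIm pu] fin.
have lp : locally_integrable setT (p \o u') by case: pRI => ->.
have mp : measurable_fun setT (p \o u') by case: lp.
have ple z : `|p z| <= normc z.
  by case: pRI => ->; [exact: Re_le_normc|exact: Im_le_normc].
split => //.
- apply: continuous_measurable_fun; apply: locally_AC_continuous acu => z w.
  by case: pRI => ->; rewrite -?ReB -?ImB; [exact: Re_le_normc|exact: Im_le_normc].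
- move=> a b ab; have E := pu a b ab.
  by case: pRI => -> /=; rewrite -?ReB -?ImB E.
- apply: le_lt_trans fin; apply: ge0_le_integral => //.
  + have mnp : measurable_fun setT (fun x => `|p (u' x)|) by exact: measurableT_comp.
    by apply/measurable_EFinP; exact: (measurable_tensor mnp mnp).
  + have mn : measurable_fun setT (fun x => normc (u' x)).
      rewrite (_ : (fun x => _) = (fun x => Num.sqrt (Re (u' x) ^+ 2 + Im (u' x) ^+ 2))).
        apply: (measurableT_comp (f := @Num.sqrt R)).
          by apply: continuous_measurable_fun; exact: sqrt_continuous.
        have [mRe _ _] := lRe; have [mIm _ _] := lIm.
        by apply: measurable_funD; apply: measurable_funX.
      by apply/funext => x; case: (u' x).
    by apply/measurable_EFinP; exact: (measurable_tensor mn mn).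
  + by move=> z _; rewrite lee_fin ler_pM.
Qed.

Lemma complex_covariance (u v u' v' : R -> R[i]) :
  locally_absolutely_continuous u -> locally_absolutely_continuous v ->
  radon_nikodym_derivative u u' -> radon_nikodym_derivative v v' ->
  (\int[lam]_z (normc (u' z.1) * normc (u' z.2))%:E < +oo)%E ->
  (\int[lam]_z (normc (v' z.1) * normc (v' z.2))%:E < +oo)%E ->
  [/\ cintegrable mu setT u, cintegrable mu setT v,
      cintegrable mu setT (fun x => u x * v x),
      cintegrable lam setT (fun z => u' z.1 * v' z.2)
    & ccov mu u v = cintegral lam setT (fun z => u' z.1 * v' z.2)].
Proof.
move=> acu acv ru rv fu fv.
have key p q (pRI : p = @Re R \/ p = @Im R) (qRI : q = @Re R \/ q = @Im R) :
  [/\ mu.-integrable setT (EFin \o (p \o u)),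
      mu.-integrable setT (EFin \o (q \o v)),
      mu.-integrable setT (EFin \o (fun x => p (u x) * q (v x))),
      lam.-integrable setT (EFin \o (fun z => p (u' z.1) * q (v' z.2)))
    & cov mu (p \o u) (q \o v) =
      Rintegral lam setT (fun z => p (u' z.1) * q (v' z.2))].
  have [m1 l1 p1 f1] := complex_components pRI acu ru fu.
  have [m2 l2 p2 f2] := complex_components qRI acv rv fv.
  exact: (real_covariance_identity m1 m2 l1 l2 p1 p2 f1 f2).
have [iu1 iv1 i11 j11 E11] := key _ _ (or_introl erefl) (or_introl erefl).
have [_ iv2 i12 j12 E12] := key _ _ (or_introl erefl) (or_intror erefl).
have [iu2 _ i21 j21 E21] := key _ _ (or_intror erefl) (or_introl erefl).
have [_ _ i22 j22 E22] := key _ _ (or_intror erefl) (or_intror erefl).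
split.
- by split.
- by split.
- split.
    by apply: eq_integrable (integrableB measurableT i11 i22) => // x _ /=; rewrite ReM.
  by apply: eq_integrable (integrableD measurableT i12 i21) => // x _ /=; rewrite ImM.
- split.
    by apply: eq_integrable (integrableB measurableT j11 j22) => // x _ /=; rewrite ReM.
  by apply: eq_integrable (integrableD measurableT j12 j21) => // x _ /=; rewrite ImM.
apply/eqP; rewrite eq_complex; apply/andP; split; apply/eqP.
- rewrite /ccov ReB ReM /=.
  under eq_Rintegral do rewrite ReM.
  under [RHS]eq_Rintegral do rewrite ReM.
  rewrite !RintegralB// -E11 -E22 /cov /comp; ring.
- rewrite /ccov ImB ImM /=.
  under eq_Rintegral do rewrite ImM.
  under [RHS]eq_Rintegral do rewrite ImM.
  rewrite !RintegralD// -E12 -E21 /cov /comp; ring.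
Qed.

End complex_case.

(** * Finiteness of the measure *)

Section second_moment.
Context {R : realType} (mu : probability (measurableTypeR R) R).
Notation leb := (@lebesgue_measure R).
Notation lam := (hoeffding_measure mu).

Lemma integral1_hoeffding : (\int[lam]_z ((1 : R) * 1)%:E = lam setT)%E.
Proof. by rewrite mulr1 integral_cst// mul1e. Qed.

(** Finite mass makes the identity function square integrable; conversely the
    mass is half the mean of [(w.2 - w.1)^2], which is at most
    [2 * w.1^2 + 2 * w.2^2]. *)
Lemma second_moment :
  (lam setT < +oo)%E <-> (\int[mu]_x (x ^+ 2)%:E < +oo)%E.
Proof.
have m1 : measurable_fun setT (cst 1 : R -> R) by [].
split=> [fl|f2].
  have pid : primitive (@id R) (cst 1).
    move=> a b ab; apply/esym.
    transitivity (1 * fine (leb `[a, b]%classic)); first exact: Rintegral_cst.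
    rewrite mul1r lebesgue_measure_itv/= lte_fin.
    by case: ltgtP ab => // -> _; rewrite subrr.
  have lid : locally_integrable setT (cst 1 : R -> R).
    by apply: continuous_locally_integrable => x; exact: cvg_cst.
  have mid : measurable_fun setT (@id R) by [].
  have fin1 : (\int[lam]_z (`|1| * `|1|)%:E < +oo)%E.
    by rewrite normr1 integral1_hoeffding.
  have /integrableP[_] := primitive_sqr_integrable mid lid pid fin1.
  apply: le_lt_trans; apply: ge0_le_integral => //.
  - by move=> x _; rewrite lee_fin sqr_ge0.
  - by apply/measurable_EFinP; exact: measurable_funX.
  - by apply: measurableT_comp => //; apply/measurable_EFinP; exact: measurable_funM.
  - by move=> x _ /=; rewrite lee_fin expr2 ler_norm.
have mx2 : measurable_fun setT (fun x : R => x ^+ 2) by exact: measurable_funX.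
have J w : (\int[leb]_x ((cst 1 x : R) * `|jump w x|)%:E = `|w.2 - w.1|%:E)%E.
  under eq_integral do rewrite /= mul1r norm_jump.
  rewrite integral_indic// setIT.
  transitivity (leb `[Num.min w.1 w.2, Num.max w.1 w.2[%classic) => //.
  rewrite lebesgue_measure_itv/= lte_fin.
  case: (ltgtP w.1 w.2) => h; last by rewrite h ltxx subrr normr0.
    by rewrite h gtr0_norm ?subr_gt0.
  by rewrite h ltr0_norm ?subr_lt0// opprB.
have E := tonelli_jump mu m1 m1 (fun=> ler01) (fun=> ler01).
suff : (2%:E * lam setT < +oo)%E.
  apply: le_lt_trans; rewrite -[leLHS]mul1e lee_pmul//.
  by rewrite lee_fin ler1n.
rewrite -integral1_hoeffding E.
under eq_integral do rewrite !J -EFinM -normrM -expr2 ger0_norm ?sqr_ge0//.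
pose q (x : R) := 2 * x ^+ 2.
have mq : measurable_fun setT q by exact: measurable_funM.
have q0 x : 0 <= q x by rewrite mulr_ge0// sqr_ge0.
have fq : (\int[mu]_x (q x)%:E < +oo)%E.
  under eq_integral do rewrite EFinM.
  rewrite ge0_integralZl//; last 2 first.
  - exact/measurable_EFinP.
  - by move=> x _; rewrite lee_fin sqr_ge0.
  by apply: lte_mul_pinfty.
have f1 : (\int[mu]_x (cst 1 x : R)%:E = 1)%E.
  transitivity (1 * mu setT)%E; first exact: (@integral_cst _ _ R mu setT measurableT 1%E).
  by rewrite mul1e probability_setT.
have mq1 := measurable_tensor mq m1; have m1q := measurable_tensor m1 mq.
apply: (@le_lt_trans _ _ (\int[mu \x mu]_w
   ((q w.1 * cst 1 w.2)%:E + (cst 1 w.1 * q w.2)%:E))%E).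
  apply: ge0_le_integral => //.
  - by move=> w _; rewrite lee_fin sqr_ge0.
  - by apply/measurable_EFinP; apply: measurable_funX; exact: measurable_funB.
  - by apply: emeasurable_funD; exact/measurable_EFinP.
  - move=> w _; rewrite -EFinD lee_fin /=.
    have := sqr_ge0 (w.1 + w.2); rewrite /q; nra.
rewrite ge0_integralD//; first last.
- exact/measurable_EFinP.
- by move=> w _; rewrite lee_fin mulr_ge0.
- exact/measurable_EFinP.
- by move=> w _; rewrite lee_fin mulr_ge0.
rewrite (ge0_integral_tensor mu mu mq m1)//.
rewrite (ge0_integral_tensor mu mu m1 mq)//.
by rewrite f1 mule1 mul1e lte_add_pinfty.
Qed.

End second_moment.

(** * Characterization of the Hoeffding measure *)

Theorem theorem1p1 (R : realType) (mu : probability (measurableTypeR R) R) :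
  [/\ locally_finite (hoeffding_measure mu) /\
      (forall u v : R -> R, Cb_infty u -> Cb_infty v ->
         covariance_identity mu (hoeffding_measure mu) u v),
      (forall lam : {measure set (measurableTypeR R * measurableTypeR R)
                       -> \bar R},
         locally_finite lam ->
         (forall u v : R -> R, Cb_infty u -> Cb_infty v ->
            covariance_identity mu lam u v) ->
         forall A, measurable A -> lam A = hoeffding_measure mu A),
      (forall u v u' v' : R -> R[i],
         locally_absolutely_continuous u ->
         locally_absolutely_continuous v ->
         radon_nikodym_derivative u u' ->
         radon_nikodym_derivative v v' ->
         (\int[hoeffding_measure mu]_z
            (normc (u' z.1) * normc (u' z.2))%:E < +oo)%E ->
         (\int[hoeffding_measure mu]_z
            (normc (v' z.1) * normc (v' z.2))%:E < +oo)%E ->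
         [/\ cintegrable mu setT u,
             cintegrable mu setT v,
             cintegrable mu setT (fun x => u x * v x),
             cintegrable (hoeffding_measure mu) setT
               (fun z => u' z.1 * v' z.2)
           & ccov mu u v = cintegral (hoeffding_measure mu) setT
                             (fun z => u' z.1 * v' z.2)])
    & (hoeffding_measure mu setT < +oo)%E <->
      (\int[mu]_x (x ^+ 2)%:E < +oo)%E].
Proof.
split.
- split; first exact: hoeffding_locally_finite.
  exact: Cb_infty_covariance.
- exact: hoeffding_measure_unique.
- exact: complex_covariance.
- exact: second_moment.
Qed.
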